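(* Let $b>0$ and let $X_{1},X_{2},\dots$ be a sequence of independent real-valued random variables with $\mathbb{E}[X_{i}]=0$ and $\mathbb{E}[X_{i}^{2}]=2b^{2}$ for all $i$, and $\sup_{i\geq1}\mathbb{E}\left[|X_{i}|^{3}\right]=\rho<\infty$. Let $p\in(0,1)$ and let $N\sim\mathrm{Geometric}(p)$ (with strictly positive support) be independent of the $X_{i}$'s. Then \[ d_{BL}\left(\mathscr{L}\left(p^{\frac{1}{2}}\sum_{i=1}^{N}X_{i}\right),\mathrm{Laplace}(0,b)\right)\leq p^{\frac{1}{2}}\,\frac{b+2}{b}\left(b\sqrt{2}+\frac{\rho}{6b^{2}}\right). \] This holds for all $p\in(0,1)$.
   Context: $\mathscr{L}(X)$ denotes the distribution (law) of $X$. $N\sim\mathrm{Geometric}(p)$ means $\mathbb{P}\{N=n\}=p(1-p)^{n-1}$ for $n\in\{1,2,3,\dots\}$. For $b>0$, $\mathrm{Laplace}(0,b)$ is the probability distribution on $\mathbb{R}$ with density $w\mapsto\frac{1}{2b}e^{-|w|/b}$. The bounded Lipschitz distance is $d_{BL}(\mathscr{L}(X),\mathscr{L}(Y))=\sup_{h\in\mathcal{H}_{BL}}|\mathbb{E}[h(X)]-\mathbb{E}[h(Y)]|$, where $\mathcal{H}_{BL}$ is the set of $h:\mathbb{R}\to\mathbb{R}$ with $\|h\|_{\infty}\leq1$ and $|h(x)-h(y)|\leq|x-y|$ for all $x,y\in\mathbb{R}$. *)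

(* Defs.v *)
From HB Require Import structures.
From mathcomp Require Import all_boot all_order all_algebra finmap.
From mathcomp Require Import all_classical all_reals all_analysis.
From mathcomp Require Import measurable_realfun.

Set Implicit Arguments.
Unset Strict Implicit.
Unset Printing Implicit Defensive.

Import Order.TTheory GRing.Theory Num.Theory.
Import numFieldNormedType.Exports.

Local Open Scope classical_set_scope.
Local Open Scope ring_scope.

(* The density is written for every real b, but is a probability density only
   for b > 0. *)
Definition laplace_pdf {R : realType} (b w : R) : R :=
  (2 * b)^-1 * expR (- `|w| / b).

(* The proof b_gt0 is an argument so that the probability instance below can be
   inferred by unification. *)
Definition laplace_prob {R : realType} (b : R) (b_gt0 : 0 < b) (V : set R)
    : \bar R :=
  (\int[lebesgue_measure]_(x in V) (laplace_pdf b x)%:E)%E.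

Section laplace_probability.
Context {R : realType}.
Variables (b : R) (b_gt0 : 0 < b).

Lemma laplace_pdf_ge0 w : 0 <= laplace_pdf b w.
Proof.
by rewrite mulr_ge0 ?expR_ge0// invr_ge0 mulr_ge0// ltW.
Qed.

Lemma continuous_laplace_pdf : continuous (laplace_pdf b).
Proof.
move=> x; apply: (@continuousM _ R^o (fun=> (2 * b)^-1)
  (fun w => expR (- `|w| / b))).
  exact: cst_continuous.
apply: (@continuous_comp _ _ _ (fun w : R => - `|w| / b) expR);
  last exact: continuous_expR.
apply: (@continuousM _ R^o (fun w : R => - `|w|) (fun=> b^-1)).
  by apply: (@continuousN _ R^o); exact: norm_continuous.
exact: cst_continuous.
Qed.

Lemma measurable_laplace_pdf : measurable_fun [set: R] (laplace_pdf b).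
Proof. by apply: continuous_measurable_fun; exact: continuous_laplace_pdf. Qed.

Lemma integral_laplace_pdf :
  (\int[lebesgue_measure]_x (laplace_pdf b x)%:E = 1)%E.
Proof.
rewrite ge0_symfun_integralT//=; first last.
- by move=> x; rewrite /laplace_pdf /= normrN.
- exact: continuous_laplace_pdf.
- exact: laplace_pdf_ge0.
have ib_gt0 : 0 < b^-1 by rewrite invr_gt0.
rewrite -(integral_exponential_pdf ib_gt0).
rewrite [X in (_ * X)%E](_ : _ =
  (\int[lebesgue_measure]_(x in `[0%R, +oo[)
     ((2^-1)%:E * (exponential_pdf b^-1 x)%:E))%E); last first.
  rewrite set_itvcy; apply: eq_integral => x; rewrite inE/= => x0.
  rewrite exponential_pdfE// /laplace_pdf ger0_norm// invfM -mulrA.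
  by rewrite EFinM mulNr mulNr [_ / b]mulrC.
rewrite ge0_integralZl//=; last 2 first.
- apply/measurable_EFinP; apply: measurable_funTS.
  exact: measurable_exponential_pdf.
- by move=> x _; rewrite lee_fin exponential_pdf_ge0// ltW.
rewrite muleA -EFinM divff// mul1e integral_mkcond.
apply: eq_integral => x _; rewrite patchE; case: ifPn => //.
by rewrite /exponential_pdf patchE => /negPf ->.
Qed.

Let laplace0 : laplace_prob b_gt0 set0 = 0%E.
Proof. by rewrite /laplace_prob integral_set0. Qed.

Let laplace_ge0 A : (0 <= laplace_prob b_gt0 A)%E.
Proof.
by rewrite /laplace_prob integral_ge0//= => x _; rewrite lee_fin laplace_pdf_ge0.
Qed.

Let laplace_sigma_additive : semi_sigma_additive (laplace_prob b_gt0).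
Proof.
move=> /= F mF tF mUF; rewrite /laplace_prob; apply: cvg_toP.
  apply: ereal_nondecreasing_is_cvgn => m n mn.
  apply: lee_sum_nneg_natr => // k _ _; apply: integral_ge0 => /= x Fkx.
  by rewrite lee_fin laplace_pdf_ge0.
rewrite ge0_integral_bigcup//=.
- apply/measurable_funTS/measurableT_comp => //.
  exact: measurable_laplace_pdf.
- by move=> x _; rewrite lee_fin laplace_pdf_ge0.
Qed.

HB.instance Definition _ := isMeasure.Build _ _ _
  (laplace_prob b_gt0) laplace0 laplace_ge0 laplace_sigma_additive.

Let laplace_setT : laplace_prob b_gt0 [set: R] = 1%E.
Proof. exact: integral_laplace_pdf. Qed.

HB.instance Definition _ :=
  @Measure_isProbability.Build _ _ R (laplace_prob b_gt0) laplace_setT.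

End laplace_probability.

Definition BL_test {R : realType} : set (R -> R) :=
  [set h | (forall x, `|h x| <= 1) /\ (forall x y, `|h x - h y| <= `|x - y|)].

Definition dBL {R : realType} (mu nu : probability R R) : \bar R :=
  ereal_sup [set `| \int[mu]_x (h x)%:E - \int[nu]_x (h x)%:E |%E
            | h in @BL_test R].

Section independence.
Context d (T : measurableType d) (R : realType) (P : probability T R).

Definition sigma_rv d' (T' : measurableType d') (X : T -> T') : set (set T) :=
  preimage_set_system setT X measurable.

Definition independent_RVs (X : nat -> {RV P >-> R}) : Prop :=
  forall (J : {fset nat}) (A : nat -> set T),
    (forall i, i \in J -> sigma_rv (X i) (A i)) ->
    (P (\bigcap_(i in [set` J]) A i) = \prod_(i <- J) P (A i))%E.

Definition independent_of_seq (N : {RV P >-> nat}) (X : nat -> {RV P >-> R})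
    : Prop :=
  forall A B : set T, sigma_rv N A -> <<s \bigcup_i sigma_rv (X i) >> B ->
    (P (A `&` B) = P A * P B)%E.

End independence.

Definition geometric_rv d (T : measurableType d) (R : realType)
    (P : probability T R) (p : R) (N : {RV P >-> nat}) : Prop :=
  forall n : nat, distribution P N [set n] =
    (if n is m.+1 then p * (1 - p) ^+ m else 0)%:E.

(* X i stands for the (i+1)-st variable of the sequence, so that the sum over
   i < N consists of the first N variables. *)
Definition scaled_random_sum d (T : measurableType d) (R : realType)
    (P : probability T R) (p : R) (N : {RV P >-> nat})
    (X : nat -> {RV P >-> R}) (w : T) : R :=
  Num.sqrt p * \sum_(i < N w) X i w.

Section scaled_random_sum.
Context d (T : measurableType d) (R : realType) (P : probability T R).
Variables (p : R) (N : {RV P >-> nat}) (X : nat -> {RV P >-> R}).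

Let measurable_scaled_random_sum :
  measurable_fun setT (scaled_random_sum p N X).
Proof.
have cover : [set: T] = \bigcup_n (N @^-1` [set n]).
  by apply/seteqP; split => // w _; exists (N w).
rewrite cover; apply/measurable_fun_bigcup.
  by move=> n; apply: measurable_funPTI.
move=> n; apply: (eq_measurable_fun (fun w => Num.sqrt p * \sum_(i < n) X i w)).
  by move=> w; rewrite inE /scaled_random_sum /= => ->.
apply: measurable_funTS; apply: measurable_funM => //.
by apply: measurable_sum => i.
Qed.

HB.instance Definition _ := isMeasurableFun.Build _ _ _ _
  (scaled_random_sum p N X) measurable_scaled_random_sum.

End scaled_random_sum.

(* Main.v *)
Require Import Defs.
From HB Require Import structures.
From mathcomp Require Import all_boot all_order all_algebra finmap.
From mathcomp Require Import all_classical all_reals all_analysis.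
From mathcomp Require Import measurable_realfun ring lra.

(** Write q = 1 - p, s = sqrt p, S_n for the n-th partial sum and W = s S_N.
    The proof is Stein's method for the Laplace law, with the geometric sum
    handled by telescoping.

    Shifting a test function by a constant changes no difference of
    expectations, so a test function h may be taken 1-Lipschitz with values
    between 0 and 2.  Let g be the average of h against the Laplace law centred
    at the argument.  Then g(0) is the Laplace expectation of h, and g solves
    g - b^2 g'' = h ([is_derive_laplace_resolvent],
    [is_derive_laplace_resolvent_derive], [integral_laplace_prob_resolvent]).
    Put k = g - h = b^2 g''.  Since |g'| <= 1 / b, the function k is Lipschitz
    with constant 1 / b + 1 <= (b + 2) / b.

    Let a_n, G_n, K_n be the expectations of h, g, k at s S_n, so that
    a_n = G_n - K_n; variables are indexed from 0, so S_(n+1) = S_n + X_n.  As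
    X_n is centred with variance 2 b^2 and independent of S_n, a second order
    Taylor expansion of g gives G_(n+1) - G_n = p K_n up to a third moment term
    ([expectation_step_taylor]), while K_(n+1) - K_n is controlled by
    E|X_n| <= b sqrt 2 ([expectation_step_lipschitz]).  Hence
    p a_(n+1) = G_n - q G_(n+1) up to an error p C, where C is the claimed bound
    ([stein_step]).  Multiplying by q^n and summing, the right-hand sides
    telescope ([geometric_telescope_le]): the sum of p q^n a_(n+1), which is
    E h(W) because N is independent of the X_i, differs from G_0 = g(0) by at
    most C.

    To differentiate g, it is split into two one-sided exponential averages,
    each of which solves a first order equation by the fundamental theorem of
    calculus.  Independence of S_n and X_n is derived from the product rule over
    finite families by induction on n ([partial_sum_indep_future]). *)

Set Implicit Arguments.
Unset Strict Implicit.
Unset Printing Implicit Defensive.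

Import Order.TTheory GRing.Theory Num.Theory.
Import numFieldNormedType.Exports.

Local Open Scope classical_set_scope.
Local Open Scope ring_scope.

(** * Taylor expansion with Lipschitz second derivative *)

Section taylor.
Context {R : realType}.
Implicit Types f g : R -> R.

Lemma is_derive_monomial (a : R) (n : nat) (x : R) :
  is_derive x 1 (fun s => a * s ^+ n.+1) (a * n.+1%:R * x ^+ n).
Proof.
have : is_derive x 1 (a \*: (@id R ^+ n.+1)) (a * n.+1%:R * x ^+ n).
  by apply: is_derive_eq; rewrite /GRing.scale/= mulr1 mulrA.
rewrite (_ : a \*: (@id R ^+ n.+1) = (fun s => a * s ^+ n.+1))//.
by apply/funext => s/=; rewrite fctE.
Qed.

Lemma is_derive_continuous f f' :
  (forall x : R, is_derive x 1 f (f' x)) -> continuous f.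
Proof.
move=> df x; apply: differentiable_continuous.
by apply/derivable1_diffP; case: (df x).
Qed.

Lemma ge0_pow_bound_of_derive f f' (c : R) (n : nat) :
  (forall t : R, is_derive t 1 f (f' t)) -> f 0 = 0 ->
  (forall t : R, 0 <= t -> f' t <= c * t ^+ n) ->
  forall t : R, 0 <= t -> f t <= c / n.+1%:R * t ^+ n.+1.
Proof.
move=> df f0 f'le t t0.
pose D s := c / n.+1%:R * s ^+ n.+1 - f s.
have dD (s : R) : is_derive s 1 D (c * s ^+ n - f' s).
  apply: (is_deriveB (is_derive_eq (is_derive_monomial _ _ _) _) (df s)).
  by field.
suff : D 0 <= D t by rewrite /D f0 expr0n/= mulr0 subr0 subr_ge0.
apply: (@ger0_derive1_ndecr _ D 0 t) => [s|s||||] //.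
- rewrite in_itv/= => /andP[/ltW s0 _].
  by rewrite derive1E derive_val subr_ge0 f'le.
- by apply: continuous_subspaceT; exact: is_derive_continuous dD.
Qed.

(** A bound on a derivative integrates to a bound on the function, on both
    sides of 0; iterating it twice gives the Taylor remainder below. *)
Lemma norm_pow_bound_of_derive f f' (c : R) (n : nat) :
  (forall t : R, is_derive t 1 f (f' t)) -> f 0 = 0 ->
  (forall t : R, `|f' t| <= c * `|t| ^+ n) ->
  forall t : R, `|f t| <= c / n.+1%:R * `|t| ^+ n.+1.
Proof.
move=> df f0 f'le.
have pos (g g' : R -> R) : (forall t : R, is_derive t 1 g (g' t)) -> g 0 = 0 ->
    (forall t : R, `|g' t| <= c * `|t| ^+ n) ->
    forall t : R, 0 <= t -> `|g t| <= c / n.+1%:R * t ^+ n.+1.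
  move=> dg g0 g'le t t0; rewrite ler_norml lerNl; apply/andP; split.
    apply: (@ge0_pow_bound_of_derive (\- g) (\- g')) => //=.
    - by rewrite g0 oppr0.
    - move=> s s0; rewrite -[s in leRHS]ger0_norm//.
      by rewrite (le_trans _ (g'le s))// -normrN ler_norm.
  apply: ge0_pow_bound_of_derive => // s s0.
  by rewrite -[s in leRHS]ger0_norm// (le_trans _ (g'le s))// ler_norm.
move=> t; have [t0|/ltW t0] := leP 0 t; first
  by rewrite (ger0_norm t0); apply: pos f'le _ _.
rewrite (ler0_norm t0) -[t in f t]opprK.
apply: (pos (fun s => f (- s)) (fun s => - f' (- s))).
- move=> s; have : is_derive s 1 (f \o -%R) (f' (- s) * -1).
    exact: (is_derive1_comp (df _) (is_deriveNid _ _)).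
  by rewrite mulrN1.
- by rewrite oppr0.
- by move=> s; rewrite normrN (le_trans (f'le _))// normrN.
- by rewrite oppr_ge0.
Qed.

(** The cubic remainder survives when the third derivative is replaced with a
    Lipschitz bound on the second: with a Lipschitz test function, the solution
    of Stein's equation has no more regularity than that. *)
Lemma taylor2_lipschitz g g' g'' (L : R) :
  (forall x : R, is_derive x 1 g (g' x)) ->
  (forall x : R, is_derive x 1 g' (g'' x)) ->
  (forall x y : R, `|g'' x - g'' y| <= L * `|x - y|) ->
  forall x t : R, `|g (x + t) - g x - t * g' x - t ^+ 2 / 2 * g'' x|
              <= L / 6 * `|t| ^+ 3.
Proof.
move=> dg dg' Lg'' x t.
have d_shift (f f' : R -> R) : (forall z : R, is_derive z 1 f (f' z)) ->
    forall s : R, is_derive s 1 (fun s => f (x + s)) (f' (x + s)).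
  move=> df s; have dx : is_derive s 1 (cst x + id : R -> R) 1.
    by apply: is_derive_eq; rewrite add0r.
  by have := is_derive1_comp (df (x + s)) dx; rewrite mulr1.
pose r1 s := g' (x + s) - g' x - g'' x * s ^+ 1.
pose r0 s := g (x + s) - g x - g' x * s ^+ 1 - g'' x / 2 * s ^+ 2.
have r1le s : `|r1 s| <= L / 2 * `|s| ^+ 2.
  apply: (@norm_pow_bound_of_derive r1 (fun s => g'' (x + s) - g'' x) L 1).
  - move=> z; have dx := is_derive_monomial (g'' x) 0 z.
    apply: (is_derive_eq (is_deriveB (is_deriveB (d_shift _ _ dg' z)
      (is_derive_cst (g' x) _ _)) dx)); ring.
  - by rewrite /r1 (addr0 x) mulr0 !subrr.
  - by move=> z; rewrite (le_trans (Lg'' _ _))// expr1 [x + z]addrC addrK.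
have -> : L / 6 = L / 2 / 3 by field.
rewrite (_ : _ - _ = r0 t); last by rewrite /r0; field.
apply: (@norm_pow_bound_of_derive r0 r1 (L / 2) 2) => //.
- move=> z; have dx1 := is_derive_monomial (g' x) 0 z.
  have dx2 := is_derive_monomial (g'' x / 2) 1 z.
  apply: (is_derive_eq (is_deriveB (is_deriveB (is_deriveB (d_shift _ _ dg z)
    (is_derive_cst (g x) _ _)) dx1) dx2)).
  by rewrite /r1; field.
- by rewrite /r0 (addr0 x) !expr0n/= !mulr0 !subrr.
Qed.

End taylor.

(** * Integration against a probability and against the Laplace law *)

Lemma bounded_integrable d (T : measurableType d) (R : realType)
    (P : probability T R) (f : T -> R) (M : R) :
  measurable_fun [set: T] f -> (forall x, `|f x| <= M) ->
  P.-integrable [set: T] (EFin \o f).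
Proof.
move=> mf fM; apply: measurable_bounded_integrable => //.
  by rewrite /= probability_setT ltry.
exists M; split; rewrite ?num_real// => z /ltW Mz x _ /=.
exact: le_trans (fM x) Mz.
Qed.

Lemma Rintegral_cst_prob d (T : measurableType d) (R : realType)
    (P : probability T R) (c : R) : \int[P]_w c = c.
Proof.
rewrite Rintegral_cst//.
have -> : fine (P setT) = 1 by rewrite probability_setT.
by rewrite mulr1.
Qed.

Section integrable_real.
Context d (T : measurableType d) (R : realType).
Variables (mu : {measure set T -> \bar R}) (f f' : T -> R).

Lemma integrable_addr : mu.-integrable setT (EFin \o f) ->
  mu.-integrable setT (EFin \o f') ->
  mu.-integrable setT (EFin \o (fun w => f w + f' w)).
Proof.
move=> mf mf'; apply: (@eq_integrable _ _ _ mu _ measurableT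
  (fun w => (f w)%:E + (f' w)%:E)%E) => //.
exact: integrableD.
Qed.

Lemma integrable_subr : mu.-integrable setT (EFin \o f) ->
  mu.-integrable setT (EFin \o f') ->
  mu.-integrable setT (EFin \o (fun w => f w - f' w)).
Proof.
move=> mf mf'; apply: (@eq_integrable _ _ _ mu _ measurableT
  (fun w => (f w)%:E - (f' w)%:E)%E) => //.
exact: integrableB.
Qed.

Lemma integrable_mulrl (c : R) : mu.-integrable setT (EFin \o f) ->
  mu.-integrable setT (EFin \o (fun w => c * f w)).
Proof.
move=> mf; apply: (@eq_integrable _ _ _ mu _ measurableT
  (fun w => c%:E * (f w)%:E)%E) => //.
exact: integrableZl.
Qed.

End integrable_real.

Lemma lipschitz1_continuous (R : realType) (h : R -> R) :
  (forall x y, `|h x - h y| <= `|x - y|) -> continuous h.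
Proof.
move=> h_lip x; apply/cvgrPdist_le => e e0; near=> t.
by rewrite (le_trans (h_lip _ _))//; near: t.
Unshelve. all: by end_near. Qed.

Section laplace_density.
Context {R : realType}.
Variables (b : R) (b_gt0 : 0 < b).
Local Notation mu := (@lebesgue_measure R).

(* The sigma-algebra generated by the half-open intervals, on which the Lebesgue
   measure lives, and the one of the real line have the same sets but are
   distinct structures: the Laplace law is transported from one to the other. *)
Let toR : R -> measurableTypeR R := idfun.

Let measurable_toR : measurable_fun setT toR.
Proof. by move=> _ A mA; rewrite setTI. Qed.

HB.instance Definition _ := isMeasurableFun.Build _ _ _ _ toR measurable_toR.

Let nu := distribution (laplace_prob b_gt0) toR.

Let nu_dominates : nu `<< mu.
Proof.
apply/null_content_dominatesP => A mA muA0; apply: null_set_integral => //.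
apply/measurable_EFinP; apply: measurable_funTS; exact: measurable_laplace_pdf.
Qed.

(** The density is the Radon-Nikodym derivative of the Laplace law, almost
    everywhere. *)
Lemma ge0_integral_laplace_prob (f : R -> R) :
  measurable_fun [set: R] f -> (forall x, 0 <= f x) ->
  (laplace_prob b_gt0).-integrable [set: R] (EFin \o f) ->
  (\int[laplace_prob b_gt0]_x (f x)%:E =
   \int[mu]_x (f x * laplace_pdf b x)%:E)%E.
Proof.
move=> mf f0 intf.
have mf' : measurable_fun [set: measurableTypeR R] (EFin \o f).
  exact/measurable_EFinP.
transitivity (\int[nu]_x (f x)%:E)%E.
  by rewrite
    (@ge0_integral_distribution _ _ _ _ _ (laplace_prob b_gt0) toR _ mf').
have intnu : nu.-integrable [set: measurableTypeR R] (EFin \o f).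
  exact: (integrable_pushforward (phi := toR)).
rewrite -(Radon_Nikodym_change_of_variables nu_dominates measurableT intnu)//=.
apply: ae_eq_integral => //.
- exact: emeasurable_funM.
- apply/measurable_EFinP; apply: measurable_funM => //.
  exact: measurable_laplace_pdf.
- have : ae_eq mu setT (Radon_Nikodym (charge_of_finite_measure nu) mu)
      (EFin \o laplace_pdf b).
    apply: integral_ae_eq => //=.
    + exact: Radon_Nikodym_integrable.
    + by apply/measurable_EFinP; exact: measurable_laplace_pdf.
    + by move=> E _ mE; rewrite -Radon_Nikodym_integral.
  exact: ae_eqe_mul2l.
Qed.

End laplace_density.

(** * The Laplace resolvent and its differential equation *)

Section laplace_resolvent.
Context {R : realType}.
Variables (b : R) (b_gt0 : 0 < b).
Local Notation mu := (@lebesgue_measure R).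
Implicit Types (h : R -> R) (x z M : R).

Lemma continuous_expR_div : continuous (fun z => expR (z / b)).
Proof.
move=> z; apply: continuous_comp; last exact: continuous_expR.
exact: mulrr_continuous.
Qed.

Lemma is_derive_expR_mul (c x : R) :
  is_derive x 1 (fun z => expR (z * c)) (c * expR (x * c)).
Proof.
have d : is_derive x 1 (fun z => z * c) c.
  have : is_derive x 1 (c \*: (@id R)) (c *: 1) by exact: is_deriveZ.
  by rewrite (_ : _ \*: _ = (fun z => z * c)) ?[_ *: _]mulr1//;
    apply/funext => z /=; rewrite mulrC.
by rewrite mulrC; exact: (is_derive1_comp (is_derive_expR _) d).
Qed.

Lemma integral_expR_Ny x :
  (\int[mu]_(z in `]-oo, x]) (expR (z / b))%:E = (b * expR (x / b))%:E)%E.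
Proof.
rewrite -[in `]-oo, x]](opprK x) ge0_integration_by_substitutionNy; first last.
- by move=> z _; exact: expR_ge0.
- by apply: continuous_subspaceT => z; exact: continuous_expR_div.
have dF (z : R) : is_derive z 1 (fun z => - b * expR (z * - b^-1))
    (expR (z * - b^-1)).
  have := is_deriveZ (- b) (is_derive_expR_mul (- b^-1) z).
  by rewrite /GRing.scale/= mulrA mulrNN divff ?gt_eqF// mul1r.
have cF := is_derive_continuous dF.
rewrite (@ge0_continuous_FTC2y _ _ (fun z => - b * expR (z * - b^-1)) _ 0).
- by rewrite sub0e mulNr EFinN oppeK mulrNN.
- by move=> z _; exact: expR_ge0.
- apply: continuous_subspaceT => z.
  apply: continuous_comp; first exact: continuousN.
  exact: continuous_expR_div.
- rewrite -[X in _ --> X](mulr0 (- b)); apply: cvgM; first exact: cvg_cst.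
  rewrite (_ : (fun x => _) =
    (fun z => expR (- z)) \o (fun z => b^-1 * z)); last first.
    by apply/funext => z /=; rewrite mulrN mulrC.
  apply: (@cvg_comp _ _ _ _ _ _ (pinfty_nbhs R)); last exact: cvgr_expR.
  by apply: gt0_cvgMry => //; rewrite invr_gt0.
- by move=> z _; case: (dF z).
- exact/cvg_at_right_filter/cF.
- move=> z _.
  by rewrite derive1E (@derive_val _ _ _ _ _ _ _ (dF z))/= mulrN mulNr.
Qed.

Lemma integrable_expR_Ny x :
  mu.-integrable `]-oo, x] (EFin \o (fun z => expR (z / b))).
Proof.
apply/integrableP; split.
  apply/measurable_EFinP; apply: measurable_funTS.
  by apply: continuous_measurable_fun => z; exact: continuous_expR_div.
under eq_integral do rewrite /= ger0_norm ?expR_ge0//.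
by rewrite integral_expR_Ny ltry.
Qed.

(** The average of [h] at [x] minus an exponential variable of mean [b]. *)
Definition exp_average h x : R :=
  b^-1 * expR (- x / b) * \int[mu]_(z in `]-oo, x]) (h z * expR (z / b)).

Section bounded.
Variables (h : R -> R) (M : R).
Hypotheses (ch : continuous h) (h0M : forall z, 0 <= h z <= M).

Let cont z : {for z, continuous (fun z => h z * expR (z / b))}.
Proof.
by apply: (@continuousM _ R^o); [exact: ch|exact: continuous_expR_div].
Qed.

Let iM x : mu.-integrable `]-oo, x] (fun z => (M * expR (z / b))%:E).
Proof.
have := @integrableZl _ _ R mu _ (measurable_itv `]-oo, x]) M _
  (integrable_expR_Ny x).
rewrite (_ : (fun z => _) = (fun z => (M * expR (z / b))%:E))//.
Qed.

Lemma integrable_exp_average x :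
  mu.-integrable `]-oo, x] (EFin \o (fun z => h z * expR (z / b))).
Proof.
have mf : measurable_fun [set: R] (fun z => h z * expR (z / b)).
  by apply: continuous_measurable_fun => z; exact: cont.
apply: le_integrable (iM x) => //.
- by apply/measurable_EFinP; apply: measurable_funTS.
- move=> z _ /=; have /andP[h0 hM] := h0M z; rewrite lee_fin.
  rewrite !ger0_norm ?mulr_ge0 ?expR_ge0 ?(le_trans h0)//.
  by rewrite ler_wpM2r ?expR_ge0.
Qed.

Lemma exp_average_ge0 x : 0 <= exp_average h x.
Proof.
apply: mulr_ge0; first by rewrite mulr_ge0 ?expR_ge0// invr_ge0 ltW.
apply: Rintegral_ge0 => z _; rewrite mulr_ge0 ?expR_ge0//.
by have /andP[] := h0M z.
Qed.

Lemma exp_average_le x : exp_average h x <= M.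
Proof.
apply: (@le_trans _ _ (b^-1 * expR (- x / b) *
    \int[mu]_(z in `]-oo, x]) (M * expR (z / b)))).
  apply: ler_wpM2l; first by rewrite mulr_ge0 ?expR_ge0// invr_ge0 ltW.
  apply: le_Rintegral => //; first exact: integrable_exp_average.
  by move=> z _; rewrite ler_wpM2r ?expR_ge0//; have /andP[] := h0M z.
rewrite RintegralZl//; last exact: integrable_expR_Ny.
rewrite [X in _ * (_ * X)](_ : _ = b * expR (x / b)); last first.
  by rewrite /Rintegral integral_expR_Ny.
rewrite mulNr expRN le_eqVlt; apply/orP; left; apply/eqP; field.
by rewrite !gt_eqF ?expR_gt0.
Qed.

(** The fundamental theorem of calculus and the product rule; the factor [1 / b]
    comes from differentiating the weight. *)
Lemma is_derive_exp_average x :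
  is_derive x 1 (exp_average h) ((h x - exp_average h x) / b).
Proof.
have x1 : x < x + 1 by rewrite ltrDl.
have [dI dIE] := @continuous_FTC1 R _ -oo%O x _ x1
  (integrable_exp_average (x + 1)) (ltNyr _) (@cont x).
have dF : is_derive x 1
    (fun x => \int[mu]_(z in `]-oo, x]) (h z * expR (z / b)))
    (h x * expR (x / b)).
  by rewrite -dIE derive1E; exact: derivableP.
have dE := is_deriveZ b^-1 (is_derive_expR_mul (- b^-1) x).
have dM := is_deriveM dE dF.
rewrite (_ : exp_average h =
  (b^-1 \*: (fun z => expR (z * - b^-1))) *
  (fun x => \int[mu]_(z in `]-oo, x]) (h z * expR (z / b)))); last first.
  by apply/funext => z; rewrite /exp_average mulNr -mulrN.
apply: is_derive_eq; rewrite /GRing.scale/= /GRing.scale/= fctE/=.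
rewrite mulrN expRN -[b^-1 *: _]/(b^-1 * _); field.
by rewrite !gt_eqF ?expR_gt0.
Qed.

End bounded.

(** The average of [h] against the Laplace law centred at [x], split into the
    contributions of the two sides of [x]; the right-hand one is the left-hand
    one of the reflected function. *)
Definition laplace_resolvent h x : R :=
  (exp_average h x + exp_average (h \o -%R) (- x)) / 2.

Definition laplace_resolvent_derive h x : R :=
  (exp_average (h \o -%R) (- x) - exp_average h x) / (2 * b).

Section resolvent.
Variables (h : R -> R) (M : R).
Hypotheses (ch : continuous h) (h0M : forall z, 0 <= h z <= M).

Let chN : continuous (h \o -%R).
Proof.
by move=> z; apply: continuous_comp; [exact: opp_continuous|exact: ch].
Qed.

Let hN0M z : 0 <= (h \o -%R) z <= M.
Proof. exact: h0M. Qed.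

Let d_left x : is_derive x 1 (exp_average h) ((h x - exp_average h x) / b).
Proof. exact: is_derive_exp_average. Qed.

Let d_right x : is_derive x 1 (fun x => exp_average (h \o -%R) (- x))
  ((exp_average (h \o -%R) (- x) - h x) / b).
Proof.
have := is_derive1_comp (is_derive_exp_average chN hN0M (- x))
  (is_deriveNid x 1).
by rewrite mulrN1 /= opprK -mulNr opprB.
Qed.

Lemma laplace_resolvent_ge0_le x : 0 <= laplace_resolvent h x <= M.
Proof.
have := exp_average_ge0 h0M x; have := exp_average_le ch h0M x.
have := exp_average_ge0 hN0M (- x); have := exp_average_le chN hN0M (- x).
rewrite /laplace_resolvent; lra.
Qed.

Lemma is_derive_laplace_resolvent x :
  is_derive x 1 (laplace_resolvent h) (laplace_resolvent_derive h x).
Proof.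
have := is_deriveZ 2^-1 (is_deriveD (d_left x) (d_right x)).
rewrite (_ : _ \*: _ = laplace_resolvent h); last first.
  by apply/funext => z; rewrite /laplace_resolvent mulrC.
move=> /is_derive_eq; apply; rewrite /laplace_resolvent_derive /GRing.scale/=.
by field; rewrite gt_eqF.
Qed.

(** This is Stein's equation [g - b ^+ 2 * g'' = h]. *)
Lemma is_derive_laplace_resolvent_derive x :
  is_derive x 1 (laplace_resolvent_derive h)
    ((laplace_resolvent h x - h x) / b ^+ 2).
Proof.
have := is_deriveZ (2 * b)^-1 (is_deriveB (d_right x) (d_left x)).
rewrite (_ : _ \*: _ = laplace_resolvent_derive h); last first.
  by apply/funext => z; rewrite /laplace_resolvent_derive [RHS]mulrC.
move=> /is_derive_eq; apply; rewrite /laplace_resolvent /GRing.scale/=.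
by field; rewrite gt_eqF.
Qed.

(** Two averages of values between 0 and [M] differ by at most [M]. *)
Lemma norm_laplace_resolvent_derive x :
  `|laplace_resolvent_derive h x| <= M / (2 * b).
Proof.
have := exp_average_ge0 h0M x; have := exp_average_le ch h0M x.
have := exp_average_ge0 hN0M (- x); have := exp_average_le chN hN0M (- x).
rewrite /laplace_resolvent_derive normrM [X in _ * X]ger0_norm; last first.
  by rewrite invr_ge0 mulr_ge0// ltW.
move=> *; rewrite ler_pM2r ?invr_gt0 ?mulr_gt0// ler_norml; lra.
Qed.

Lemma laplace_resolvent_lipschitz x y :
  `|laplace_resolvent h x - laplace_resolvent h y| <= M / (2 * b) * `|x - y|.
Proof.
wlog xy : x y / y <= x.
  move=> H; have [/H//|/ltW/H] := leP y x.
  by rewrite distrC (distrC y x).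
have [|z _ ->] := MVT_segment xy (fun z _ => is_derive_laplace_resolvent z).
  apply: continuous_subspaceT.
  exact: is_derive_continuous is_derive_laplace_resolvent.
by rewrite normrM ler_wpM2r// norm_laplace_resolvent_derive.
Qed.

Lemma integral_laplace_prob_resolvent :
  (\int[laplace_prob b_gt0]_x (h x)%:E = (laplace_resolvent h 0)%:E)%E.
Proof.
have h0 x : 0 <= h x by have /andP[] := h0M x.
have mh : measurable_fun [set: R] h by exact: continuous_measurable_fun.
have chl : continuous (fun x => h x * laplace_pdf b x).
  move=> x; apply: (@continuousM _ R^o); first exact: ch.
  exact: continuous_laplace_pdf.
have mhl : measurable_fun [set: R] (fun x => (h x * laplace_pdf b x)%:E).
  by apply/measurable_EFinP; exact: continuous_measurable_fun.
rewrite ge0_integral_laplace_prob//; last first.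
  apply: (@bounded_integrable _ _ _ _ _ M) => // x.
  by rewrite ger0_norm//; have /andP[] := h0M x.
have half (f : R -> R) : continuous f -> (forall z, 0 <= f z <= M) ->
    (\int[mu]_(x in `]-oo, 0%R]) (f x * laplace_pdf b x)%:E =
      (exp_average f 0 / 2)%:E)%E.
  move=> cf f0M.
  transitivity (\int[mu]_(x in `]-oo, 0%R])
      ((2 * b)^-1%:E * (f x * expR (x / b))%:E))%E.
    apply: eq_integral => x; rewrite inE/= in_itv/= => x0.
    by rewrite -EFinM /laplace_pdf ler0_norm// opprK mulrCA.
  rewrite integralZl//; last exact: (integrable_exp_average cf f0M).
  rewrite -[X in (_ * X)%E]fineK; last first.
    by apply: integrable_fin_num => //; exact: (integrable_exp_average cf f0M).
  rewrite -EFinM /exp_average oppr0 mul0r expR0 /Rintegral; congr (_%:E).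
  by field; rewrite gt_eqF.
rewrite -(setUv `]-oo, 0%R]) ge0_integral_setU//=; last 4 first.
- exact: measurableC.
- by rewrite setUv.
- by move=> x _; rewrite lee_fin mulr_ge0// laplace_pdf_ge0.
- exact/disj_setPCl.
rewrite half// setCitvl.
rewrite integral_itv_obnd_cbnd; last exact: measurable_funTS.
(* The integrand is written as a reflected one, so that the half-line of
   positive reals is brought back to the case of the other half-line. *)
have -> : (\int[mu]_(x in `[0%R, +oo[) (h x * laplace_pdf b x)%:E =
    \int[mu]_(x in `[0%R, +oo[)
      (((fun x => (h \o -%R) x * laplace_pdf b x) \o -%R) x)%:E)%E.
  by apply: eq_integral => x _; rewrite /= opprK /laplace_pdf normrN.
rewrite -ge0_integration_by_substitutionNy.
- by rewrite oppr0 half// -EFinD /laplace_resolvent oppr0 mulrDl.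
- apply: continuous_subspaceT => x.
  by apply: (@continuousM _ R^o); [exact: chN|exact: continuous_laplace_pdf].
- by move=> x _; apply: mulr_ge0; [exact: h0|exact: laplace_pdf_ge0].
Qed.

End resolvent.

End laplace_resolvent.

(** * Independence of an event, of pairs, and expectations *)

Section event_independence.
Context d (T : measurableType d) (R : realType) (P : probability T R).
Local Open Scope ereal_scope.

Let prob_fineE (A : set T) (mA : measurable A) : P A = (fine (P A))%:E.
Proof. by rewrite fineK// fin_num_measure. Qed.

(** The law of [Y] under [P] restricted to [A] is [P A] times the law of [Y]. *)
Lemma ge0_integral_indep_event d' (U : measurableType d') (Y : {RV P >-> U})
    (A : set T) (f : U -> \bar R) :
  measurable A ->
  (forall B, measurable B -> P (A `&` Y @^-1` B) = P A * P (Y @^-1` B)) ->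
  measurable_fun [set: U] f -> (forall y, 0 <= f y) ->
  \int[P]_(w in A) f (Y w) = P A * \int[P]_w f (Y w).
Proof.
move=> mA AY mf f0.
have mfY : measurable_fun [set: T] (f \o Y) by exact: measurableT_comp.
pose PA := mrestr P mA.
pose c : {nonneg R} := NngNum (fine_ge0 (measure_ge0 P A)).
transitivity (\int[PA]_(w in A) f (Y w)).
  apply: eq_measure_integral => B mB BA.
  by rewrite /= /mrestr setIidl.
transitivity (\int[PA]_w f (Y w)).
  rewrite -[in RHS](setUv A) ge0_integral_setU//=; last 3 first.
  - exact: measurableC.
  - by rewrite setUv.
  - exact/disj_setPCl.
  rewrite [X in _ = _ + X]null_set_integral ?adde0//.
  - exact: measurableC.
  - exact: measurable_funTS.
  - by rewrite /= /mrestr setICl measure0.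
transitivity (\int[pushforward PA Y]_y f y).
  by rewrite ge0_integral_pushforward.
transitivity (\int[mscale c (distribution P Y)]_y f y).
  apply: eq_measure_integral => B mB _.
  rewrite /= /mscale /pushforward /= /mrestr setIC AY//.
  by rewrite -prob_fineE.
rewrite ge0_integral_mscale//= -prob_fineE//.
by rewrite ge0_integral_distribution.
Qed.

(** Rectangles form a generating pi-system of the product, so that independence
    from [C] passes from rectangles to all events of the pair. *)
Lemma indep_event_pair d1 d2 (U1 : measurableType d1) (U2 : measurableType d2)
    (Y : {RV P >-> U1}) (Z : {RV P >-> U2}) (C : set T) :
  measurable C ->
  (forall A B, measurable A -> measurable B ->
    P (Y @^-1` A `&` Z @^-1` B `&` C) = P (Y @^-1` A `&` Z @^-1` B) * P C) ->
  forall D : set (U1 * U2), measurable D ->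
    P ([set w | D (Y w, Z w)] `&` C) = P [set w | D (Y w, Z w)] * P C.
Proof.
move=> mC YZC D mD.
have mYZ : measurable_fun [set: T] (fun w => (Y w, Z w)).
  exact: measurable_fun_pair.
pose YZ : {mfun T >-> (U1 * U2)%type} :=
  HB.pack (fun w => (Y w, Z w)) (isMeasurableFun.Build _ _ _ _ _ mYZ).
pose c : {nonneg R} := NngNum (fine_ge0 (measure_ge0 P C)).
pose m1 := pushforward (mrestr P mC) YZ.
pose m2 := mscale c (distribution P YZ).
suff : m1 D = m2 D.
  rewrite /= /m1 /m2 /mscale /pushforward /= /mrestr => ->.
  by rewrite muleC -prob_fineE.
pose G : set (set (U1 * U2)) :=
  [set E | exists A, measurable A /\ exists B, measurable B /\ E = A `*` B].
apply: (measure_unique G (fun=> setT)) => //.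
- rewrite measurable_prod_measurableType; congr (<<s _ >>).
  apply/seteqP; split => [_ [A mA [B mB <-]]|_ [A [mA [B [mB ->]]]]].
    by exists A; split => //; exists B.
  by exists A => //; exists B.
- move=> _ _ [A1 [mA1 [A2 [mA2 ->]]]] [B1 [mB1 [B2 [mB2 ->]]]].
  rewrite -setXI; exists (A1 `&` B1); split; first exact: measurableI.
  by exists (A2 `&` B2); split => //; exact: measurableI.
- move=> _; exists setT; split => //; exists setT; split => //.
  by rewrite setXTT.
- by apply/seteqP; split => // x _; exists 0%N.
- move=> _ [A [mA [B [mB ->]]]].
  rewrite /= /m1 /m2 /mscale /pushforward /= /mrestr.
  rewrite -prob_fineE// muleC -YZC//.
- move=> _; rewrite /= /m1 /pushforward /= /mrestr preimage_setT setTI.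
  exact: le_lt_trans (probability_le1 _ _) (ltry _).
Qed.

(** Fubini: a bound on the expectation with the first variable frozen, uniform
    in the frozen value, is a bound on the joint expectation. *)
Lemma integral_indep_pair_le d1 d2 (U1 : measurableType d1)
    (U2 : measurableType d2) (Y : {RV P >-> U1}) (Z : {RV P >-> U2})
    (F : U1 * U2 -> R) (M c : R) :
  (forall A B, measurable A -> measurable B ->
    P (Y @^-1` A `&` Z @^-1` B) = P (Y @^-1` A) * P (Z @^-1` B)) ->
  measurable_fun [set: U1 * U2] F -> (forall z, (`|F z| <= M)%R) ->
  (forall y, `|\int[P]_w (F (y, Z w))%:E| <= c%:E) ->
  `|\int[P]_w (F (Y w, Z w))%:E| <= c%:E.
Proof.
move=> YZ mF FM Fc.
have mYZ : measurable_fun [set: T] (fun w => (Y w, Z w)).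
  exact: measurable_fun_pair.
pose V : {mfun T >-> (U1 * U2)%type} :=
  HB.pack (fun w => (Y w, Z w)) (isMeasurableFun.Build _ _ _ _ _ mYZ).
have mEF : measurable_fun [set: U1 * U2] (EFin \o F) by exact/measurable_EFinP.
have iF : (distribution P Y \x distribution P Z).-integrable setT (EFin \o F).
  apply: measurable_bounded_integrable => //.
    rewrite -setXTT [ltLHS]product_measure1E//.
    rewrite [X in X * _](probability_setT (distribution P Y)).
    by rewrite [X in _ * X](probability_setT (distribution P Z)) mule1 ltry.
  exists M; split; rewrite ?num_real// => z /ltW Mz x _ /=.
  exact: le_trans (FM x) Mz.
have FY y : \int[distribution P Z]_z (F (y, z))%:E = \int[P]_w (F (y, Z w))%:E.
  have mFy : measurable_fun [set: U2] (fun z => F (y, z)).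
    by apply: (measurableT_comp mF); exact: measurable_pair1.
  rewrite (@integral_distribution _ _ _ _ _ P Z (fun z => (F (y, z))%:E))//.
    exact/measurable_EFinP.
  apply: (@bounded_integrable _ _ _ _ (fun w => F (y, Z w)) M) => //.
  exact: (measurableT_comp mFy).
have -> : \int[P]_w (F (Y w, Z w))%:E =
    \int[distribution P Y]_y \int[distribution P Z]_z (F (y, z))%:E.
  have /= -> := integral12_prod_meas1 iF.
  transitivity (\int[distribution P V]_z (F z)%:E).
    rewrite (@integral_distribution _ _ _ _ _ P V _ mEF)//.
    apply: (@bounded_integrable _ _ _ _ (F \o V) M) => //.
      exact: measurableT_comp.
    by move=> w; exact: FM.
  apply: eq_measure_integral => D mD _; apply/esym.
  by apply: product_measure_unique => // A B mA mB; exact: YZ.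
have mG := measurable_fubini_F iF.
apply: le_trans (le_abse_integral _ measurableT mG) _.
apply: (@le_trans _ _ (\int[distribution P Y]_y c%:E)); last first.
  by rewrite integral_cst//= probability_setT mule1.
apply: ge0_le_integral => //.
- exact: measurableT_comp.
- by move=> y _; rewrite /fubini_F FY.
Qed.

End event_independence.

(** * Partial sums *)

Section partial_sum.
Context d (T : measurableType d) (R : realType) (P : probability T R).
Variable X : nat -> {RV P >-> R}.
Local Open Scope ereal_scope.

Definition partial_sum n (w : T) : R := (\sum_(i < n) X i w)%R.

Let measurable_partial_sum n : measurable_fun setT (partial_sum n).
Proof. by apply: measurable_sum => i. Qed.

HB.instance Definition _ n := isMeasurableFun.Build _ _ _ _
  (partial_sum n) (measurable_partial_sum n).

Lemma partial_sumS n w : partial_sum n.+1 w = (partial_sum n w + X n w)%R.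
Proof. by rewrite /partial_sum big_ord_recr. Qed.

Lemma sigma_rv_preimage i B : measurable B -> sigma_rv (X i) (X i @^-1` B).
Proof. by move=> mB; exists B => //; rewrite setTI. Qed.

Lemma sigma_rv_measurable i A : sigma_rv (X i) A -> measurable A.
Proof. by move=> [B mB <-]; rewrite setTI; exact: measurable_funPTI. Qed.

Lemma partial_sum_preimage_generated n B : measurable B ->
  <<s \bigcup_i sigma_rv (X i) >> (partial_sum n @^-1` B).
Proof.
pose G := \bigcup_i sigma_rv (X i).
have mX i : measurable_fun [set: g_sigma_algebraType G] (X i).
  move=> _ A mA; rewrite setTI; apply: sub_sigma_algebra.
  by exists i => //; exact: sigma_rv_preimage.
have mS : measurable_fun [set: g_sigma_algebraType G] (partial_sum n).
  by apply: measurable_sum => i; exact: mX.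
by move=> mB; have := mS measurableT _ mB; rewrite setTI.
Qed.

Hypothesis X_indep : independent_RVs X.

(** Induction on [n], with the events of all later variables carried along.  If
    [C] is an event of the variables after [n], the induction hypothesis for the
    family enlarged with [n] makes rectangle events of [partial_sum n] and [X n]
    independent of [C]; hence so is every event of that pair, among which the
    preimages under addition are the events of the next partial sum. *)
Lemma partial_sum_indep_future n (J : {fset nat}) (A : nat -> set T) B :
  measurable B ->
  (forall j, j \in J -> (n <= j)%N) ->
  (forall j, j \in J -> sigma_rv (X j) (A j)) ->
  P (partial_sum n @^-1` B `&` \bigcap_(j in [set` J]) A j) =
  P (partial_sum n @^-1` B) * P (\bigcap_(j in [set` J]) A j).
Proof.
elim: n J A B => [|n IH] J A B mB nJ sA.
  have [B0|B0] := pselect (B 0%R).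
    have -> : partial_sum 0 @^-1` B = setT.
      by apply/seteqP; split => // w _; rewrite /= /partial_sum big_ord0.
    by rewrite setTI probability_setT mul1e.
  have -> : partial_sum 0 @^-1` B = set0.
    by apply/seteqP; split => // w; rewrite /= /partial_sum big_ord0.
  by rewrite set0I measure0 mul0e.
set C := \bigcap_(j in _) _.
have mC : measurable C.
  apply: fin_bigcap_measurable => // j /= jJ.
  exact: sigma_rv_measurable (sA j jJ).
have nJF : n \notin J by apply/negP => /nJ; rewrite ltnn.
pose D : set (R * R) := [set x | B (x.1 + x.2)%R].
have mD : measurable D.
  have mp : measurable_fun [set: R * R] (fun x : R * R => (x.1 + x.2)%R).
    by apply: measurable_funD.
  by rewrite -[D]setTI; exact: mp.
have -> : partial_sum n.+1 @^-1` B = [set w | D (partial_sum n w, X n w)].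
  by apply/seteqP; split => w; rewrite /D /= partial_sumS.
apply: (indep_event_pair (Y := partial_sum n) (Z := X n)) => // B1 B2 mB1 mB2.
pose A' j := if j == n then X n @^-1` B2 else A j.
have A'J j : j \in J -> A' j = A j.
  by move=> jJ; rewrite /A'; case: eqP => // jn; rewrite -jn jJ in nJF.
have A'n : A' n = X n @^-1` B2 by rewrite /A' eqxx.
have sA' j : j \in (n |` J)%fset -> sigma_rv (X j) (A' j).
  rewrite in_fset1U => /predU1P[->|jJ]; last by rewrite A'J//; exact: sA.
  by rewrite A'n; exact: sigma_rv_preimage.
have capE : X n @^-1` B2 `&` C = \bigcap_(j in [set` (n |` J)%fset]) A' j.
  rewrite bigcap_fsetU1 A'n; congr (_ `&` _).
  by apply: eq_bigcapr => j /= jJ; rewrite A'J.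
have capP : P (X n @^-1` B2 `&` C) = P (X n @^-1` B2) * P C.
  rewrite capE X_indep// big_fsetU1//= A'n; congr (_ * _).
  by rewrite X_indep//; apply: eq_big_seq => j jJ; rewrite A'J.
have -> : P (partial_sum n @^-1` B1 `&` X n @^-1` B2) =
    P (partial_sum n @^-1` B1) * P (X n @^-1` B2).
  have := IH [fset n]%fset (fun=> X n @^-1` B2) B1 mB1.
  rewrite set_fset1 bigcap_set1; apply.
    by move=> j; rewrite in_fset1 => /eqP->.
  by move=> j; rewrite in_fset1 => /eqP->; exact: sigma_rv_preimage.
rewrite -setIA capE IH//.
  by rewrite -capE capP muleA.
by move=> j; rewrite in_fset1U => /predU1P[->//|/nJ/ltnW].
Qed.

Lemma partial_sum_indep_next n B1 B2 : measurable B1 -> measurable B2 ->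
  P (partial_sum n @^-1` B1 `&` X n @^-1` B2) =
  P (partial_sum n @^-1` B1) * P (X n @^-1` B2).
Proof.
move=> mB1 mB2.
have := @partial_sum_indep_future n [fset n]%fset (fun=> X n @^-1` B2) B1 mB1.
rewrite set_fset1 bigcap_set1; apply.
  by move=> j; rewrite in_fset1 => /eqP->.
by move=> j; rewrite in_fset1 => /eqP->; exact: sigma_rv_preimage.
Qed.

End partial_sum.

(** * Moments of one summand *)

Section moments.
Context d (T : measurableType d) (R : realType) (P : probability T R).
Variables (Z : {RV P >-> R}) (v rho : R).
Hypotheses (EZ : ('E_P[Z] = 0)%E)
  (EZ2 : ('E_P[fun w => (Z w ^+ 2)%R] = v%:E)%E)
  (EZ3 : ('E_P[fun w => (`|Z w| ^+ 3)%R] <= rho%:E)%E).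

Lemma integrable_sqr : P.-integrable setT (EFin \o (fun w => Z w ^+ 2)).
Proof.
apply/integrableP; split; first exact/measurable_EFinP/measurable_funX.
under eq_integral do rewrite /= ger0_norm ?sqr_ge0//.
by move: EZ2; rewrite unlock /= => ->; rewrite ltry.
Qed.

Lemma integrable_cube : P.-integrable setT (EFin \o (fun w => `|Z w| ^+ 3)).
Proof.
apply/integrableP; split.
  by apply/measurable_EFinP/measurable_funX; exact: measurableT_comp.
under eq_integral do rewrite /= ger0_norm ?exprn_ge0//.
by move: EZ3; rewrite unlock => /le_lt_trans; apply; rewrite ltry.
Qed.

Lemma integrable_id : P.-integrable setT (EFin \o Z).
Proof.
have i1 : P.-integrable setT (EFin \o (fun w => 1 + Z w ^+ 2)).
  apply: integrable_addr integrable_sqr.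
  by apply: (@bounded_integrable _ _ _ _ (cst 1) 1) => // w; rewrite normr1.
apply: le_integrable i1 => //; first exact/measurable_EFinP.
move=> w _ /=; rewrite lee_fin [leRHS]ger0_norm ?addr_ge0 ?sqr_ge0//.
rewrite -real_normK ?num_real//; have := sqr_ge0 (`|Z w| - 1); nra.
Qed.

Lemma Rintegral_id : \int[P]_w Z w = 0.
Proof. by move: EZ; rewrite unlock /Rintegral => ->. Qed.

Lemma Rintegral_sqr : \int[P]_w (Z w ^+ 2) = v.
Proof. by move: EZ2; rewrite unlock /Rintegral => ->. Qed.

Lemma Rintegral_cube : \int[P]_w (`|Z w| ^+ 3) <= rho.
Proof.
move: EZ3; rewrite unlock -[leLHS]fineK ?lee_fin//.
exact: integrable_fin_num integrable_cube.
Qed.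

Lemma integrable_norm : P.-integrable setT (EFin \o (fun w => `|Z w|)).
Proof.
by move/integrable_abse : integrable_id; apply: eq_integrable.
Qed.

(** Integrating [2 * |z| * sqrt v <= z ^+ 2 + v]. *)
Lemma Rintegral_norm_le : 0 < v -> \int[P]_w `|Z w| <= Num.sqrt v.
Proof.
move=> v0; have s0 : 0 < Num.sqrt v by rewrite sqrtr_gt0.
have cst1 : P.-integrable setT (EFin \o cst (Num.sqrt v / 2)).
  by apply: (@bounded_integrable _ _ _ _ _ `|Num.sqrt v / 2|).
have isq : P.-integrable setT
    (EFin \o (fun w => (2 * Num.sqrt v)^-1 * Z w ^+ 2)).
  exact: integrable_mulrl integrable_sqr.
apply: (@le_trans _ _
  (\int[P]_w ((2 * Num.sqrt v)^-1 * Z w ^+ 2 + Num.sqrt v / 2))).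
  apply: le_Rintegral => //; first exact: integrable_norm.
    exact: integrable_addr isq cst1.
  move=> w _; rewrite -[Z w ^+ 2]real_normK ?num_real// -subr_ge0.
  rewrite (_ : _ - _ = (`|Z w| - Num.sqrt v) ^+ 2 / (2 * Num.sqrt v)).
    by rewrite divr_ge0 ?sqr_ge0// mulr_ge0// ltW.
  by field; rewrite gt_eqF.
rewrite RintegralD// RintegralZl//; last exact: integrable_sqr.
rewrite Rintegral_sqr Rintegral_cst_prob.
rewrite -[X in _ * X + _](sqr_sqrtr (ltW v0)).
rewrite le_eqVlt; apply/orP; left; apply/eqP; field.
by rewrite gt_eqF.
Qed.

Lemma norm_integral_taylor2_le (g g' g'' : R -> R) (L z s : R) :
  (forall x : R, is_derive x 1 g (g' x)) ->
  (forall x : R, is_derive x 1 g' (g'' x)) ->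
  (forall x y : R, `|g'' x - g'' y| <= L * `|x - y|) ->
  0 <= s ->
  `|\int[P]_w (g (z + s * Z w) - g z - s ^+ 2 * v / 2 * g'' z)| <=
  L / 6 * s ^+ 3 * rho.
Proof.
move=> dg dg' Lg'' s0.
have mg : measurable_fun [set: R] g.
  by apply: continuous_measurable_fun; exact: is_derive_continuous dg.
pose r w :=
  g (z + s * Z w) - g z - (s * Z w) * g' z - (s * Z w) ^+ 2 / 2 * g'' z.
have rle w : `|r w| <= L / 6 * s ^+ 3 * `|Z w| ^+ 3.
  rewrite (le_trans (taylor2_lipschitz dg dg' Lg'' _ _))// normrM exprMn mulrA.
  by rewrite (ger0_norm s0).
have icube :
    P.-integrable setT (EFin \o (fun w => L / 6 * s ^+ 3 * `|Z w| ^+ 3)).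
  exact: integrable_mulrl integrable_cube.
have msZ : measurable_fun [set: T] (fun w => s * Z w) by exact: measurable_funM.
have ir : P.-integrable setT (EFin \o r).
  apply: le_integrable icube => //.
    apply/measurable_EFinP; apply: measurable_funB; last first.
      apply: measurable_funM => //; apply: measurable_funM => //.
      exact: measurable_funX.
    apply: measurable_funB; last exact: measurable_funM.
    apply: measurable_funB => //; apply: (measurableT_comp mg).
    exact: measurable_funD.
  by move=> w _ /=; rewrite lee_fin (le_trans (rle w))// ler_norm.
have iZ : P.-integrable setT (EFin \o (fun w => s * g' z * Z w)).
  exact: integrable_mulrl integrable_id.
have icst : P.-integrable setT (EFin \o cst v).
  by apply: (@bounded_integrable _ _ _ _ (cst v) `|v|).
have iv : P.-integrable setT (EFin \o (fun w => Z w ^+ 2 - v)).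
  exact: integrable_subr integrable_sqr icst.
have iZ2 : P.-integrable setT
    (EFin \o (fun w => s ^+ 2 / 2 * g'' z * (Z w ^+ 2 - v))).
  exact: integrable_mulrl iv.
have irZ : P.-integrable setT (EFin \o (fun w => r w + s * g' z * Z w)).
  exact: integrable_addr ir iZ.
(* The linear term and the centred quadratic term have expectation 0. *)
have -> : \int[P]_w (g (z + s * Z w) - g z - s ^+ 2 * v / 2 * g'' z) =
    \int[P]_w r w.
  transitivity (\int[P]_w
      (r w + s * g' z * Z w + s ^+ 2 / 2 * g'' z * (Z w ^+ 2 - v))).
    by apply: eq_Rintegral => w _; rewrite /r; field.
  rewrite RintegralD// RintegralD// !RintegralZl//; last exact: integrable_id.
  rewrite (RintegralB measurableT integrable_sqr icst).
  rewrite Rintegral_id Rintegral_sqr Rintegral_cst_prob.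
  by rewrite subrr !mulr0 !addr0.
apply: le_trans (le_normr_Rintegral _ _) _ => //.
apply: (@le_trans _ _ (\int[P]_w (L / 6 * s ^+ 3 * `|Z w| ^+ 3))).
  apply: le_Rintegral => //.
    exact: (integrable_abse ir).
rewrite RintegralZl//; last exact: integrable_cube.
rewrite ler_wpM2l ?Rintegral_cube// mulr_ge0 ?exprn_ge0// divr_ge0//.
by have := Lg'' 1 0; rewrite subr0 normr1 mulr1; exact: le_trans.
Qed.

End moments.

(** * Stein's method along the partial sums *)

Section stein.
Context d (T : measurableType d) (R : realType) (P : probability T R).
Variables (b : R) (b_gt0 : 0 < b) (X : nat -> {RV P >-> R}) (rho : R).
Hypotheses (X_indep : independent_RVs X)
  (X_mean : forall i, ('E_P[X i] = 0)%E)
  (X_var : forall i, ('E_P[fun w => (X i w ^+ 2)%R] = (2 * b ^+ 2)%R%:E)%E)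
  (X_third : forall i, ('E_P[fun w => (`|X i w| ^+ 3)%R] <= rho%:E)%E).
Variables (s : R) (s_ge0 : 0 <= s).
Variables (h : R -> R).
Hypotheses (h02 : forall x, 0 <= h x <= 2)
  (h_lip : forall x y, `|h x - h y| <= `|x - y|).

Let h_cont : continuous h := lipschitz1_continuous h_lip.

Let g := laplace_resolvent b h.
Let k x := g x - h x.
Let L := (b + 2) / b.

Let L_ge0 : 0 <= L.
Proof. by rewrite divr_ge0 ?addr_ge0// ltW. Qed.

Let k_lip x y : `|k x - k y| <= L * `|x - y|.
Proof.
have -> : k x - k y = (g x - g y) - (h x - h y) by rewrite /k; ring.
rewrite (le_trans (ler_normB _ _))//.
have := laplace_resolvent_lipschitz b_gt0 h_cont h02 x y.
have -> : 2 / (2 * b) = b^-1 by field; rewrite gt_eqF.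
(* The part g of k contributes 1 / b to the constant and the part h contributes
   1; the claimed constant is 1 + 2 / b. *)
move=> /lerD/(_ (h_lip x y))/le_trans; apply.
rewrite -[X in _ + X]mul1r -mulrDl ler_wpM2r//.
rewrite /L mulrDl divff ?gt_eqF// addrC lerD2l.
by rewrite -[leLHS]mul1r ler_wpM2r ?invr_ge0 ?ler1n// ltW.
Qed.

Let g_le x : `|g x| <= 2.
Proof.
have /andP[g0 g2] := laplace_resolvent_ge0_le b_gt0 h_cont h02 x.
by rewrite ger0_norm.
Qed.

Let h_le x : `|h x| <= 2.
Proof. by have /andP[h0 h2] := h02 x; rewrite ger0_norm. Qed.

Let k_le x : `|k x| <= 4.
Proof.
rewrite (le_trans (ler_normB _ _))// (le_trans (lerD (g_le _) (h_le _)))//.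
by rewrite -natrD.
Qed.

Let mg : measurable_fun [set: R] g.
Proof.
apply: continuous_measurable_fun; apply: is_derive_continuous => x.
exact: (is_derive_laplace_resolvent b_gt0 h_cont h02).
Qed.

Let mh : measurable_fun [set: R] h.
Proof. exact: continuous_measurable_fun. Qed.

Let mk : measurable_fun [set: R] k.
Proof. exact: measurable_funB. Qed.

Let mS n : measurable_fun [set: T] (fun w => s * partial_sum X n w).
Proof. exact: measurable_funM. Qed.

Let int_comp (f : R -> R) M n : measurable_fun [set: R] f ->
  (forall x, `|f x| <= M) ->
  P.-integrable setT (EFin \o (fun w => f (s * partial_sum X n w))).
Proof.
move=> mf fM; apply: (@bounded_integrable _ _ _ _ _ M).
  exact: (measurableT_comp mf (mS n)).
by move=> w; exact: fM.
Qed.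

Let Ef (f : R -> R) n := \int[P]_w f (s * partial_sum X n w).

Lemma expectation_step_lipschitz n :
  `|Ef k n.+1 - Ef k n| <= s * L * (b * Num.sqrt 2).
Proof.
have ik j := int_comp j mk k_le.
rewrite /Ef -RintegralB//.
have ikB : P.-integrable setT
    (EFin \o
      (fun w => k (s * partial_sum X n.+1 w) - k (s * partial_sum X n w))).
  exact: integrable_subr (ik _) (ik _).
have inX : P.-integrable setT (EFin \o (fun w => `|X n w|)).
  exact: integrable_norm (X_var n).
apply: le_trans (le_normr_Rintegral _ _) _ => //.
apply: (@le_trans _ _ (\int[P]_w (s * L * `|X n w|))).
  apply: le_Rintegral => //.
  - exact: (integrable_abse ikB).
  - exact: integrable_mulrl inX.
  - move=> w _; rewrite (le_trans (k_lip _ _))//.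
    rewrite partial_sumS mulrDr addrC addKr.
    by rewrite normrM (ger0_norm s_ge0) mulrA (mulrC L).
rewrite RintegralZl//; apply: ler_wpM2l; first exact: mulr_ge0 s_ge0 L_ge0.
have v0 : 0 < 2 * b ^+ 2 by rewrite mulr_gt0 ?exprn_gt0.
rewrite (le_trans (Rintegral_norm_le (X_var n) v0))//.
by rewrite mulrC sqrtrM ?sqr_ge0// sqrtr_sqr gtr0_norm.
Qed.

(** With the partial sum frozen, the quadratic term of the Taylor expansion has
    expectation [s ^+ 2 * b ^+ 2 * g''], which is [s ^+ 2 * k]. *)
Lemma expectation_step_taylor n :
  `|Ef g n.+1 - Ef g n - s ^+ 2 * Ef k n| <= s ^+ 3 * L * (rho / (6 * b ^+ 2)).
Proof.
pose c := s ^+ 3 * L * (rho / (6 * b ^+ 2)).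
pose F (x : R * R) :=
  g (s * x.1 + s * x.2) - g (s * x.1) - s ^+ 2 * k (s * x.1).
have mF : measurable_fun [set: R * R] F.
  have m1 : measurable_fun [set: R * R] (fun x : R * R => s * x.1).
    exact: measurable_funM.
  apply: measurable_funB.
    apply: measurable_funB; last exact: (measurableT_comp mg).
    apply: (measurableT_comp mg); apply: measurable_funD => //.
    exact: measurable_funM.
  by apply: measurable_funM => //; exact: (measurableT_comp mk).
have FM x : `|F x| <= 2 + 2 + s ^+ 2 * 4.
  rewrite (le_trans (ler_normB _ _))// lerD//.
    by rewrite (le_trans (ler_normB _ _))// lerD.
  by rewrite normrM ger0_norm ?exprn_ge0// ler_wpM2l ?exprn_ge0.
have Fc y : (`|\int[P]_w (F (y, X n w))%:E| <= c%:E)%E.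
  have iFy : P.-integrable setT (EFin \o (fun w => F (y, X n w))).
    apply: (@bounded_integrable _ _ _ _ _ (2 + 2 + s ^+ 2 * 4)).
      apply: (measurableT_comp mF).
      exact: measurable_fun_pair.
    by move=> w; exact: FM.
  rewrite -EFin_normr_Rintegral// lee_fin.
  have lip x z : `|(g x - h x) / b ^+ 2 - (g z - h z) / b ^+ 2| <=
      L / b ^+ 2 * `|x - z|.
    have b2 : 0 <= (b ^+ 2)^-1 by rewrite invr_ge0 exprn_ge0// ltW.
    rewrite -mulrBl normrM (ger0_norm b2) mulrAC.
    by apply: ler_wpM2r => //; exact: k_lip.
  have := norm_integral_taylor2_le (X_mean n) (X_var n) (X_third n)
    (s * y) (is_derive_laplace_resolvent b_gt0 h_cont h02)
    (is_derive_laplace_resolvent_derive b_gt0 h_cont h02) lip s_ge0.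
  rewrite (_ : L / b ^+ 2 / 6 * s ^+ 3 * rho = c); last first.
    by rewrite /c; field; rewrite gt_eqF.
  apply: le_trans; rewrite le_eqVlt; apply/orP; left; apply/eqP.
  congr `|_|; apply: eq_Rintegral => w _; rewrite /F /k /g /=.
  by field; rewrite gt_eqF.
have := integral_indep_pair_le (Y := partial_sum X n) (Z := X n)
  (partial_sum_indep_next X_indep n) mF FM Fc.
have ig j := int_comp j mg g_le.
have ik := int_comp n mk k_le.
have iF : P.-integrable setT (EFin \o (fun w => F (partial_sum X n w, X n w))).
  apply: (@bounded_integrable _ _ _ _ _ (2 + 2 + s ^+ 2 * 4)).
    apply: (measurableT_comp mF).
    exact: measurable_fun_pair.
  by move=> w; exact: FM.
rewrite -EFin_normr_Rintegral// lee_fin.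
apply: le_trans; rewrite le_eqVlt; apply/orP; left; apply/eqP; congr `|_|.
have igB : P.-integrable setT
    (EFin \o
      (fun w => g (s * partial_sum X n.+1 w) - g (s * partial_sum X n w))).
  exact: integrable_subr (ig _) (ig _).
have ikZ : P.-integrable setT
    (EFin \o (fun w => s ^+ 2 * k (s * partial_sum X n w))).
  exact: integrable_mulrl ik.
have := RintegralB measurableT igB ikZ.
rewrite (RintegralB measurableT (ig n.+1) (ig n)).
rewrite (RintegralZl _ measurableT ik).
move=> <-; apply: eq_Rintegral => w _.
by rewrite /F /= partial_sumS mulrDr.
Qed.

(** The Taylor step produces [k] at the partial sum of index [n], whereas [h] is
    evaluated at index [n.+1]; the Lipschitz step bridges the two. *)
Lemma stein_step n :
  `|s ^+ 2 * Ef h n.+1 - (Ef g n - (1 - s ^+ 2) * Ef g n.+1)| <=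
  s ^+ 2 * (s * L * (b * Num.sqrt 2 + rho / (6 * b ^+ 2))).
Proof.
have split (x y z t u : R) : u * (x - z) - (y - (1 - u) * x) =
    (x - y - u * t) - u * (z - t) by ring.
have -> : Ef h n.+1 = Ef g n.+1 - Ef k n.+1.
  have := RintegralB measurableT (int_comp n.+1 mg g_le)
    (int_comp n.+1 mk k_le).
  by move=> <-; apply: eq_Rintegral => w _; rewrite /k subKr.
rewrite (split _ _ _ (Ef k n)).
apply: le_trans (ler_normB _ _) _.
have s2 : 0 <= s ^+ 2 by exact: exprn_ge0.
rewrite (normrM (s ^+ 2)) (ger0_norm s2) addrC mulrDr mulrDr.
apply: lerD; last first.
  apply: le_trans (expectation_step_taylor n) _.
  by rewrite exprSr !mulrA.
rewrite ler_wpM2l//.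
exact: expectation_step_lipschitz.
Qed.

Lemma expectation_resolvent0 : Ef g 0 = g 0.
Proof.
rewrite /Ef (@eq_Rintegral _ _ _ _ _ (fun=> g 0)) ?Rintegral_cst_prob//.
by move=> w _; rewrite /partial_sum big_ord0 mulr0.
Qed.

Lemma norm_expectation_resolvent_le n : `|Ef g n| <= 2.
Proof.
have ig := int_comp n mg g_le.
apply: le_trans (le_normr_Rintegral _ ig) _ => //.
apply: (@le_trans _ _ (\int[P]_w 2)).
  apply: le_Rintegral => //; first exact: (integrable_abse ig).
    apply: (@bounded_integrable _ _ _ _ (cst 2) 2) => // w.
    by rewrite /= ger0_norm.
by rewrite Rintegral_cst_prob.
Qed.

End stein.

(** * Summation over the geometric number of terms *)

(** The errors sum to [p * C] times a truncated geometric series; keeping its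
    exact value [C * (1 - (1 - p) ^+ m)] makes the induction go through. *)
Lemma geometric_telescope_le (R : realType) (a G : nat -> R) (p C : R) :
  0 <= p <= 1 -> 0 <= C ->
  (forall n, `|p * a n.+1 - (G n - (1 - p) * G n.+1)| <= p * C) ->
  forall m, `|\sum_(0 <= n < m) p * (1 - p) ^+ n * a n.+1 -
              (G 0%N - (1 - p) ^+ m * G m)| <= C.
Proof.
move=> /andP[p0 p1] C0 step m; have q0 : 0 <= 1 - p by rewrite subr_ge0.
suff : `|\sum_(0 <= n < m) p * (1 - p) ^+ n * a n.+1 -
    (G 0%N - (1 - p) ^+ m * G m)| <= C * (1 - (1 - p) ^+ m).
  move=> /le_trans; apply; rewrite -[leRHS]mulr1 ler_wpM2l// gerBl.
  exact: exprn_ge0.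
elim: m => [|m IH].
  by rewrite big_nil expr0 mul1r !subrr mulr0 normr0.
rewrite big_nat_recr//=.
have := ler_wpM2l (exprn_ge0 m q0) (step m).
rewrite -[X in X * `|_|](ger0_norm (exprn_ge0 m q0)) -normrM => stepm.
have := lerD IH stepm; move/(le_trans (ler_normD _ _)).
congr (`|_| <= _); rewrite exprS; ring.
Qed.

(** On the event that [N] is [n], the random sum is a fixed partial sum, whose
    events belong to the sigma-algebra of the sequence, from which [N] is
    independent. *)
Lemma ge0_integral_random_sum d (T : measurableType d) (R : realType)
    (P : probability T R) (p : R) (N : {RV P >-> nat})
    (X : nat -> {RV P >-> R}) (f : R -> R) :
  independent_of_seq N X -> measurable_fun setT f -> (forall x, 0 <= f x) ->
  (\int[P]_w (f (scaled_random_sum p N X w))%:E =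
   \sum_(n <oo) distribution P N [set n] *
     \int[P]_w (f (Num.sqrt p * partial_sum X n w))%:E)%E.
Proof.
move=> NX mf f0.
have mN n : measurable (N @^-1` [set n]) by exact: measurable_funPTI.
have cover : [set: T] = \bigcup_n (N @^-1` [set n]).
  by apply/seteqP; split => // w _; exists (N w).
rewrite [in LHS]cover ge0_integral_bigcup//; last 3 first.
- rewrite -cover; apply/measurable_EFinP; exact: (measurableT_comp mf).
- by move=> w _; rewrite lee_fin.
- apply/trivIsetP => i j _ _ ij; apply/seteqP; split => // w [/= -> /eqP].
  by rewrite (negbTE ij).
apply: eq_eseriesr => n _.
transitivity (\int[P]_(w in N @^-1` [set n])
    (f (Num.sqrt p * partial_sum X n w))%:E)%E.
  by apply: eq_integral => w; rewrite inE /scaled_random_sum /= => ->.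
rewrite (ge0_integral_indep_event (Y := partial_sum X n)
  (f := fun x => (f (Num.sqrt p * x))%:E))//.
- move=> B mB; apply: NX; last exact: partial_sum_preimage_generated.
  by exists [set n] => //; rewrite setTI.
- apply/measurable_EFinP; apply: (measurableT_comp mf).
  exact: measurable_funM.
- by move=> y; rewrite lee_fin.
Qed.

(** * The bound for one test function, and for the distance *)

Section limit.
Context d (T : measurableType d) (R : realType) (P : probability T R).
Variables (b : R) (b_gt0 : 0 < b) (X : nat -> {RV P >-> R}) (rho : R).
Hypotheses (X_indep : independent_RVs X)
  (X_mean : forall i, ('E_P[X i] = 0)%E)
  (X_var : forall i, ('E_P[fun w => (X i w ^+ 2)%R] = (2 * b ^+ 2)%R%:E)%E)
  (X_third : forall i, ('E_P[fun w => (`|X i w| ^+ 3)%R] <= rho%:E)%E).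
Variables (p : R) (p_gt0 : 0 < p) (p_lt1 : p < 1) (N : {RV P >-> nat}).
Hypotheses (N_geom : geometric_rv p N) (NX_indep : independent_of_seq N X).

Lemma norm_random_sum_resolvent_le (h : R -> R) :
  (forall x, 0 <= h x <= 2) ->
  (forall x y, `|h x - h y| <= `|x - y|) ->
  `|\int[P]_w h (scaled_random_sum p N X w) - laplace_resolvent b h 0| <=
  Num.sqrt p * ((b + 2) / b) * (b * Num.sqrt 2 + rho / (6 * b ^+ 2)).
Proof.
move=> h02 h_lip; set C := (leRHS).
have h_cont := lipschitz1_continuous h_lip.
have mh : measurable_fun [set: R] h by exact: continuous_measurable_fun.
have h0 x : 0 <= h x by have /andP[] := h02 x.
have h2 x : `|h x| <= 2 by rewrite ger0_norm//; have /andP[] := h02 x.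
pose s := Num.sqrt p.
have s0 : 0 <= s by exact: sqrtr_ge0.
have sp : s ^+ 2 = p by rewrite sqr_sqrtr// ltW.
pose a n := \int[P]_w h (s * partial_sum X n w).
pose G n := \int[P]_w laplace_resolvent b h (s * partial_sum X n w).
have rho0 : 0 <= rho.
  rewrite -lee_fin; apply: le_trans (X_third 0%N).
  by apply: expectation_ge0 => w; exact: exprn_ge0.
have C0 : 0 <= C.
  have b0 := ltW b_gt0; apply: mulr_ge0.
    by apply: mulr_ge0 => //; apply: divr_ge0 => //; exact: addr_ge0.
  apply: addr_ge0; first by apply: mulr_ge0 => //; exact: sqrtr_ge0.
  by apply: divr_ge0 => //; apply: mulr_ge0 => //; exact: exprn_ge0.
have step n : `|p * a n.+1 - (G n - (1 - p) * G n.+1)| <= p * C.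
  have := stein_step b_gt0 X_indep X_mean X_var X_third s0 h02 h_lip n.
  by rewrite sp.
have p01 : 0 <= p <= 1 by rewrite !ltW.
have tel := geometric_telescope_le p01 C0 step.
pose u m := \sum_(0 <= n < m) p * (1 - p) ^+ n * a n.+1.
pose v m := G 0 - (1 - p) ^+ m * G m.
have ihW : P.-integrable setT (EFin \o (h \o scaled_random_sum p N X)).
  apply: (@bounded_integrable _ _ _ _ _ 2); first exact: measurableT_comp.
  by move=> w; exact: h2.
have ih n : P.-integrable setT (EFin \o (fun w => h (s * partial_sum X n w))).
  apply: (@bounded_integrable _ _ _ _ _ 2).
    by apply: (measurableT_comp mh); exact: measurable_funM.
  by move=> w; exact: h2.
have cu : u m @[m --> \oo] --> \int[P]_w h (scaled_random_sum p N X w).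
  have hser := ge0_integral_random_sum p NX_indep mh h0.
  pose t n := (distribution P N [set n] *
     \int[P]_w (h (Num.sqrt p * partial_sum X n w))%:E)%E.
  have t0 n : (0 <= t n)%E.
    by rewrite mule_ge0// integral_ge0// => w _; rewrite lee_fin.
  have ct : (\sum_(0 <= i < n) t i)%E @[n --> \oo] -->
      (\int[P]_w h (scaled_random_sum p N X w))%:E.
    rewrite /Rintegral fineK; last exact: integrable_fin_num ihW.
    rewrite hser; apply: is_cvg_nneseries => n _ _; exact: t0.
  (* The law of [N] does not charge 0, so the series starts one step later. *)
  have tE m : (\sum_(0 <= i < m.+1) t i)%E = (u m)%:E.
    rewrite big_nat_recl// {1}/t N_geom mul0e add0e /u -sumEFin.
    apply: eq_bigr => i _; rewrite /t N_geom [RHS]EFinM; congr (_ * _)%E.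
    by rewrite /a /Rintegral fineK//; exact: integrable_fin_num (ih _).
  move: ct; rewrite -(cvg_shiftS (fun n => \sum_(0 <= i < n) t i)%E) => ct.
  have /fine_cvg : (u m)%:E @[m --> \oo] -->
      (\int[P]_w h (scaled_random_sum p N X w))%:E.
    rewrite (_ : (fun m => _) = (fun m => (\sum_(0 <= i < m.+1) t i)%E))//.
    by apply/funext => m; rewrite tE.
  exact.
have cv : v m @[m --> \oo] --> laplace_resolvent b h 0.
  have <- : G 0 = laplace_resolvent b h 0 by exact: expectation_resolvent0.
  rewrite -[X in _ --> X]subr0.
  apply: cvgB; first exact: cvg_cst.
  have q1 : `|1 - p| < 1 by rewrite ger0_norm ?subr_ge0 ?ltW// gtrBl.
  have cq : ((1 - p) ^+ m * 2) @[m --> \oo] --> (0 : R).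
    by rewrite -(mul0r 2); apply: cvgM; [exact: cvg_expr|exact: cvg_cst].
  apply/norm_cvg0P; apply: (squeeze_cvgr _ _ cq); last exact: cvg_cst.
  apply: nearW => m; rewrite normr_ge0/= normrM ger0_norm; last first.
    by rewrite exprn_ge0 ?subr_ge0 ?ltW.
  apply: ler_wpM2l; first by rewrite exprn_ge0 ?subr_ge0 ?ltW.
  exact: norm_expectation_resolvent_le.
have cD : `|u m - v m| @[m --> \oo] -->
    `|\int[P]_w h (scaled_random_sum p N X w) - laplace_resolvent b h 0|.
  by apply: cvg_norm; exact: cvgB cu cv.
have <- := cvg_lim (@Rhausdorff R) cD.
apply: limr_le; first exact: cvgP cD.
by apply: nearW => m; exact: tel.
Qed.

End limit.

Theorem theorem1p3 (R : realType) (d : measure_display) (T : measurableType d)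
    (P : probability T R) (b : R) (b_gt0 : 0 < b)
    (X : nat -> {RV P >-> R}) (rho : R)
    (X_indep : independent_RVs X)
    (X_mean : forall i, ('E_P[X i] = 0)%E)
    (X_var : forall i, ('E_P[fun w => (X i w ^+ 2)%R] = (2 * b ^+ 2)%R%:E)%E)
    (X_third :
      ereal_sup (range (fun i => 'E_P[fun w => (`|X i w| ^+ 3)%R]%E)) = rho%:E)
    (p : R) (p_gt0 : 0 < p) (p_lt1 : p < 1)
    (N : {RV P >-> nat}) (N_geom : geometric_rv p N)
    (NX_indep : independent_of_seq N X) :
  (dBL (distribution P (scaled_random_sum p N X)) (laplace_prob b_gt0)
    <= (Num.sqrt p * ((b + 2) / b)
        * (b * Num.sqrt 2 + rho / (6 * b ^+ 2)))%:E)%E.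
Proof.
have third i : ('E_P[fun w => (`|X i w| ^+ 3)%R] <= rho%:E)%E.
  by rewrite -X_third; apply: ereal_sup_ubound; exists i.
apply: ge_ereal_sup => _ [h [h1 h_lip] <-].
(* The shift makes the test function nonnegative, so that Tonelli-type lemmas
   apply, and leaves the difference of the two integrals unchanged. *)
pose h' x := h x + 1.
have h'02 x : 0 <= h' x <= 2.
  by have := h1 x; rewrite ler_norml /h' => /andP[? ?]; lra.
have h'_lip x y : `|h' x - h' y| <= `|x - y|.
  by rewrite (_ : _ - _ = h x - h y) ?h_lip// /h'; ring.
have h'_cont : continuous h'.
  exact: lipschitz1_continuous.
have mh' : measurable_fun [set: R] h' by exact: continuous_measurable_fun.
have shift (Q : probability R R) :
    (\int[Q]_x (h x)%:E = \int[Q]_x (h' x)%:E - 1)%E.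
  have ih' : Q.-integrable setT (EFin \o h').
    apply: (@bounded_integrable _ _ _ _ _ 2) => // x.
    by have /andP[? ?] := h'02 x; rewrite ger0_norm.
  have i1 : Q.-integrable setT (EFin \o cst 1).
    by apply: (@bounded_integrable _ _ _ _ (cst 1) 1) => // x; rewrite normr1.
  transitivity (\int[Q]_x ((h' x)%:E - (cst 1 x)%:E))%E.
    by apply: eq_integral => x _; rewrite -EFinB /h' addrK.
  rewrite integralB_EFin//; congr (_ - _)%E.
  rewrite (integral_cst Q measurableT 1%:E).
  by rewrite [X in (_ * X)%E](probability_setT Q) mule1.
have ihW : P.-integrable setT (EFin \o (h' \o scaled_random_sum p N X)).
  apply: (@bounded_integrable _ _ _ _ _ 2); first exact: measurableT_comp.
  move=> w; have /andP[? ?] := h'02 (scaled_random_sum p N X w).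
  by rewrite /= ger0_norm.
rewrite !shift (integral_laplace_prob_resolvent b_gt0 h'_cont h'02).
rewrite integral_distribution//; last exact/measurable_EFinP.
rewrite -[X in (`|X - _ - _|)%E]fineK; last exact: integrable_fin_num ihW.
rewrite -!EFinB lee_fin.
rewrite [X in `|X|](_ : _ =
  \int[P]_w h' (scaled_random_sum p N X w) - laplace_resolvent b h' 0).
  exact: (norm_random_sum_resolvent_le b_gt0 X_indep X_mean X_var third).
by rewrite /Rintegral /=; ring.
Qed.
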